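(* Let $k$ be a field, $R=k[x_1,\dots,x_n]$ the standard graded polynomial ring, $\Gamma=k_{DP}[X_1,\dots,X_n]$ the divided power ring regarded as an $R$-module by contraction, and $d$ an integer with $1\le d\le n$. Let $\mathcal H=\{H_L : L\in\mathbb N_+^d,\ |L|\le t_0\}$ be an admissible set of homogeneous elements of $\Gamma$ with respect to a linear sequence $\underline z=z_1,\dots,z_d$, with $t_0\ge (r+2)d$, where $r=\deg H_{\mathbf 1_d}$. Assume that there exists a graded Gorenstein $k$-algebra $A=R/I$ of dimension $d$ ($I$ a homogeneous ideal of $R$) such that $(I+(\underline z^L))^\perp=\langle H_L\rangle$ for all $L\in\mathbb N_+^d$ with $|L|\le t_0$. Then $$I=\operatorname{Ann}_R\big(H_{(\mathbf{r+2})_d}\big)_{\le r+1}\,R,$$ that is, $I$ is the ideal of $R$ generated by the elements of degree at most $r+1$ of $\operatorname{Ann}_R(H_{(\mathbf{r+2})_d})$.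
   Context: Divided power ring and contraction. $\Gamma=k_{DP}[X_1,\dots,X_n]$ is the $k$-vector space with basis the divided power monomials $X^{[L]}$, $L\in\mathbb N^n$, graded by $\deg X^{[L]}=|L|=\sum l_i$; set $X^{[L]}=0$ if $L\in\mathbb Z^n$ has a negative component. $R$ acts on $\Gamma$ by contraction: for $h=\sum_M a_Mx^M\in R$ and $F=\sum_L b_LX^{[L]}\in\Gamma$, $h\circ F=\sum_{M,L}a_Mb_LX^{[L-M]}$. $\langle F\rangle$ denotes the cyclic $R$-submodule of $\Gamma$ generated by $F$. For an ideal $J\subset R$, $J^\perp=\{g\in\Gamma: J\circ g=0\}$. For $F\in\Gamma$, $\operatorname{Ann}_R(F)=\{f\in R: f\circ F=0\}$. Multi-indices. $\mathbb N_+$ is the set of positive integers; $|L|=l_1+\dots+l_d$ for $L=(l_1,\dots,l_d)$; $\mathbf 1_d=(1,\dots,1)\in\mathbb N^d$ and, for a positive integer $t$, $\mathbf t_d=(t,\dots,t)\in\mathbb N^d$, so $(\mathbf{r+2})_d=(r+2,\dots,r+2)$; $\gamma_i\in\mathbb N^d$ is the $i$-th coordinate vector. $(\underline z^L)$ is the ideal generated by $z_1^{l_1},\dots,z_d^{l_d}$. A linear sequence $z_1,\dots,z_d$ means linear forms in $R_1$ that are part of a $k$-basis of $R_1$. Admissible set. A family $\{H_L: L\in\mathbb N_+^d,\ |L|\le t_0\}\subset\Gamma$ is admissible with respect to $z_1,\dots,z_d$ if the following two conditions hold for all indices such that every multi-index involved has total degree at most $t_0$: (1) for all $i=1,\dots,d$: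 $z_i\circ H_L=H_{L-\gamma_i}$ if $l_i\ge2$, and $z_i\circ H_L=0$ if $l_i=1$; (2) for all $i=1,\dots,d$: $\operatorname{Ann}_R(H_L)\circ H_{L+\gamma_i}=\langle H_{L-(l_i-1)\gamma_i}\rangle$, where $\operatorname{Ann}_R(H_L)\circ H_{L+\gamma_i}=\{f\circ H_{L+\gamma_i}: f\in\operatorname{Ann}_R(H_L)\}$. The expression $\deg H_{\mathbf 1_d}$ presupposes $H_{\mathbf 1_d}\neq0$. *)

(* Defs.v *)
From HB Require Import structures.
From mathcomp Require Export all_boot all_order all_algebra ring_quotient.
From mathcomp Require Export boolp classical_sets.
From mathcomp Require Export mpoly.

Set Implicit Arguments.
Unset Strict Implicit.
Unset Printing Implicit Defensive.

Import GRing.Theory.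
Local Open Scope ring_scope.
Local Open Scope classical_set_scope.

(* Pitfall: idealr_closed includes properness (1 is not a member). *)
Section Ideals.
Variable R : comNzRingType.
Implicit Types (I J S : set R) (s : seq R).

Definition ideal_gen S : set R :=
  [set f | exists s : seq (R * R),
      (forall p, p \in s -> S p.2) /\ f = \sum_(p <- s) p.1 * p.2].

Definition ideal_add I J : set R := [set f + g | f in I & g in J].

Definition prime_ideal (P : set R) : Prop :=
  idealr_closed (mem P) /\ prime_idealr_closed (mem P).

(* Primes of R/I are the primes of R containing I. *)
Definition has_prime_chain I (m : nat) : Prop :=
  exists P : nat -> set R,
    (forall i, (i <= m)%N -> prime_ideal (P i) /\ I `<=` P i) /\
    (forall i, (i < m)%N -> P i `<` P i.+1).

Definition krull_dim_quot I (d : nat) : Prop :=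
  has_prime_chain I d /\ forall m, has_prime_chain I m -> (m <= d)%N.

(* s is an (R/I)-regular sequence. *)
Definition regular_sequence I s : Prop :=
  (forall i, (i < size s)%N -> forall f,
     ideal_add I (ideal_gen [set` take i s]) (s`_i * f) ->
     ideal_add I (ideal_gen [set` take i s]) f) /\
  ~ ideal_add I (ideal_gen [set` s]) 1.

End Ideals.

Section Graded.
Variables (k : fieldType) (n : nat).
Local Notation R := {mpoly k[n]}.
Implicit Types (I J : set R).

Definition homogeneous_ideal I : Prop :=
  idealr_closed (mem I) /\ forall f e, I f -> I (pihomog mdeg e f).

(* The preimage in R of the socle (0 : m) of R/J, m = (x_1, ..., x_n). *)
Definition socle_lift J : set R := [set f | forall i : 'I_n, J ('X_i * f)].

(* dim_k Soc(R/J) = 1 *)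
Definition socle_dim1 J : Prop :=
  exists u, [/\ socle_lift J u, ~ J u &
    forall f, socle_lift J f -> exists c : k, J (f - c *: u)].

(* R/I is a Gorenstein graded k-algebra of dimension d, i.e. a d-dimensional
   Cohen-Macaulay algebra of type 1: it has a regular sequence of d homogeneous
   elements of positive degree modulo which the socle is one-dimensional. *)
Definition gorenstein_quot I (d : nat) : Prop :=
  [/\ homogeneous_ideal I, krull_dim_quot I d &
    exists s : d.-tuple R,
      [/\ forall a, a \in s -> exists2 e, (0 < e)%N & a \is e.-homog,
          regular_sequence I s &
          socle_dim1 (ideal_add I (ideal_gen [set` s]))]].

Definition is_kbasis (V : lmodType k) (m : nat) (b : 'I_m -> V) : Prop :=
  forall v : V, exists! c : {ffun 'I_m -> k}, v = \sum_i c i *: b i.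

(* z_1, ..., z_d are among the members of a k-basis of R_1. *)
Definition linear_sequence (d : nat) (z : 'I_d -> R) : Prop :=
  exists m (b : 'I_m -> dhomog n k 1) (j : 'I_d -> 'I_m),
    [/\ is_kbasis b, injective j & forall i, z i = b (j i)].

(* The divided power ring as a graded k-vector space: the basis vector X^[L] is
   stored as the monomial 'X_[L].  Its R-module structure is contract below; the
   product of {mpoly k[n]} is not that of the divided power ring and plays no
   role. *)
Definition dpring : Type := {mpoly k[n]}.
HB.instance Definition _ := GRing.Lmodule.copy dpring {mpoly k[n]}.
Implicit Types (F g : dpring).

Definition dpX (L : 'X_{1..n}) : dpring := 'X_[L].
Definition dpcoef F (L : 'X_{1..n}) : k := mcoeff L F.
Definition dpsupp F : seq 'X_{1..n} := msupp F.
Definition dphomog (e : nat) F : Prop :=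
  forall L, L \in dpsupp F -> mdeg L = e.

(* Subtraction of multi-indices is truncated, hence the guard (M <= L)%MM. *)
Definition contract (h : R) F : dpring :=
  \sum_(M <- msupp h) \sum_(L <- dpsupp F | (M <= L)%MM)
    (h@_M * dpcoef F L) *: dpX (L - M)%MM.

Definition cyclic F : set dpring := range (contract^~ F).
Definition perp J : set dpring := [set g | forall h, J h -> contract h g = 0].
Definition Ann F : set R := [set f | contract f F = 0].

End Graded.

Section Admissible.
Variables (k : fieldType) (n d : nat).
Local Notation R := {mpoly k[n]}.
Implicit Types (L : 'X_{1..d}) (z : 'I_d -> R).

Definition mpos L : Prop := forall i, (0 < L i)%N.
Definition mconst (t : nat) : 'X_{1..d} := [multinom t | i < d].

Definition zpow_ideal z L : set R := ideal_gen (range (fun i => z i ^+ L i)).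

(* H is total; only its values at L in N_+^d with |L| <= t0 are relevant. *)
Definition admissible (t0 : nat) z (H : 'X_{1..d} -> dpring k n) : Prop :=
  (forall L i, mpos L -> (mdeg L <= t0)%N ->
     contract (z i) (H L) = if (2 <= L i)%N then H (L - U_(i))%MM else 0) /\
  (forall L i, mpos L -> (mdeg (L + U_(i))%MM <= t0)%N ->
     [set contract f (H (L + U_(i))%MM) | f in Ann (H L)] =
     cyclic (H (L - U_(i) *+ (L i).-1)%MM)).

End Admissible.

(* Main.v *)
From HB Require Import structures.
Require Import Defs.

Set Implicit Arguments.
Unset Strict Implicit.
Unset Printing Implicit Defensive.

Import GRing.Theory.
Local Open Scope ring_scope.
Local Open Scope classical_set_scope.

(** The theorem is a Castelnuovo-Mumford regularity bound combined with Macaulay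
    duality.

    Since (I + (z))^perp = <H_(1,...,1)> lives in degrees at most r, duality puts
    every form of degree greater than r in I + (z)
    ([inverse_system_cofinite]); that is, A/(z) vanishes in degrees above r.  As
    A has a regular sequence of length d made of forms of positive degree, and
    powers of these forms lie in I + (z), the sequence z itself is acyclic on A.
    This is proved with Koszul homology: (z) annihilates H_q(z; A), so the
    members of the regular sequence act nilpotently on it, whereas the long exact
    sequence of A -> A -> A/(s) makes them act injectively as soon as
    H_(q+1)(z; A/(s)) = 0.  Starting from the trivial vanishing in exterior
    degree d + 1 and descending along the d terms of the sequence one reaches
    H_1(z; A) = 0 ([koszul_exact_regular_sequence]), that is, the intersection of
    I with (z) is (z) I ([koszul_exact1]).

    Hence I is generated in degrees at most r + 1 ([generated_in_low_degree]):
    modulo (z), the image of I contains all forms of degree above r, so it needs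
    no generator of degree r + 2 or more, and (z) I only contributes multiples of
    elements of I of lower degree.

    It remains to compare low degrees.  By duality Ann(H_(r+2,...,r+2)) equals
    I + (z_1^(r+2), ..., z_d^(r+2)) ([annihilator_sub] is the nontrivial
    inclusion), and this coincides with I in degrees at most r + 1 because the
    added generators have degree r + 2. *)

(** * Ideals as sets *)

Section Ideals.
Variable R : comNzRingType.
Implicit Types (I J S : set R).

(** Ideals in the usual sense; the unit ideal is allowed. *)
Definition is_ideal J : Prop :=
  J 0 /\ forall x u v, J u -> J v -> J (x * u + v).

Lemma is_idealD J u v : is_ideal J -> J u -> J v -> J (u + v).
Proof. by move=> JI Ju; rewrite -[u]mul1r; apply: JI.2. Qed.

Lemma is_idealM J x u : is_ideal J -> J u -> J (x * u).
Proof.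
by move=> JI Ju; rewrite -[_ * _]addr0; apply: JI.2 => //; apply: JI.1.
Qed.

Lemma is_idealB J u v : is_ideal J -> J u -> J v -> J (u - v).
Proof. by move=> JI Ju Jv; rewrite addrC -mulN1r; apply: JI.2. Qed.

Lemma is_ideal_sum J (K : Type) (s : seq K) (P : pred K) (F : K -> R) :
  is_ideal J -> (forall i, P i -> J (F i)) -> J (\sum_(i <- s | P i) F i).
Proof.
by move=> JI JF; elim/big_ind: _ => //;
  [exact: JI.1 | move=> *; exact: is_idealD].
Qed.

Lemma idealr_closed_is_ideal I : idealr_closed (mem I) -> is_ideal I.
Proof.
case=> I0 _ IS; split; first by move: I0; rewrite inE.
by move=> x u v Iu Iv; have := IS x u v; rewrite !inE; apply.
Qed.

Lemma ideal_gen_sub S : S `<=` ideal_gen S.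
Proof.
move=> f Sf; exists [:: (1, f)]; split; last by rewrite big_seq1 mul1r.
by move=> p; rewrite inE => /eqP->.
Qed.

Lemma ideal_gen_min S J : is_ideal J -> S `<=` J -> ideal_gen S `<=` J.
Proof.
move=> JI SJ f [s [sS ->]]; rewrite big_seq_cond; apply: is_ideal_sum => // p.
by case/andP=> /sS/SJ Jp _; apply: is_idealM.
Qed.

Lemma ideal_gen_is_ideal S : is_ideal (ideal_gen S).
Proof.
split; first by exists [::]; split; rewrite ?big_nil.
move=> x u v [s [sS ->]] [t [tS ->]].
exists ([seq (x * p.1, p.2) | p <- s] ++ t); split.
  by move=> p; rewrite mem_cat => /orP[/mapP[q /sS ? ->]|/tS].
rewrite big_cat big_map mulr_sumr /=; congr (_ + _).
by apply: eq_bigr => p _; rewrite mulrA.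
Qed.

Lemma ideal_add_is_ideal I J :
  is_ideal I -> is_ideal J -> is_ideal (ideal_add I J).
Proof.
move=> II JI; split.
  by exists 0; [exact: II.1 | exists 0; [exact: JI.1 | rewrite addr0]].
move=> x _ _ [u Iu [v Jv <-]] [u' Iu' [v' Jv' <-]].
exists (x * u + u'); first exact: II.2.
by exists (x * v + v'); [exact: JI.2 | rewrite mulrDr addrACA].
Qed.

Lemma ideal_addl I J : J 0 -> I `<=` ideal_add I J.
Proof. by move=> J0 f If; exists f => //; exists 0 => //; rewrite addr0. Qed.

(** The ideal J + (s), in a form that displays the coefficient of s. *)
Definition ideal_addp J s : set R := [set f | exists x, J (f - s * x)].

(** The successive quotients in [regular_sequence] add one generator at a
    time. *)
Lemma ideal_add_gen_rcons I t x : is_ideal I ->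
  ideal_add I (ideal_gen [set` rcons t x]) =
  ideal_addp (ideal_add I (ideal_gen [set` t])) x.
Proof.
move=> II; have genI S := ideal_gen_is_ideal S.
apply/seteqP; split=> [_ [u Iu [v gv <-]]|f [y hy]].
  suff: ideal_gen [set` rcons t x] `<=` ideal_addp (ideal_gen [set` t]) x.
    case/(_ v gv)=> y hy; exists y; exists u => //.
    by exists (v - x * y); rewrite // addrA.
  apply: ideal_gen_min.
    split; first by exists 0; rewrite mulr0 subr0; apply: (genI _).1.
    move=> a f g [b hb] [c hc]; exists (a * b + c).
    have -> : a * f + g - x * (a * b + c) = a * (f - x * b) + (g - x * c).
      by rewrite mulrDr mulrBr opprD addrACA mulrCA.
    exact: (genI _).2.
  move=> f /=; rewrite mem_rcons inE => /orP[/eqP->|tf].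
    by exists 1; rewrite mulr1 subrr; apply: (genI _).1.
  by exists 0; rewrite mulr0 subr0; apply: ideal_gen_sub.
have tsub : ideal_gen [set` t] `<=` ideal_gen [set` rcons t x].
  apply: ideal_gen_min => // g /= tg; apply: ideal_gen_sub.
  by rewrite /= mem_rcons inE tg orbT.
case: hy => [u Iu [v gv e]].
exists u => //; exists (y * x + v); last first.
  by rewrite addrCA e mulrC addrC subrK.
apply: (genI _).2; last exact: tsub.
by apply: ideal_gen_sub; rewrite /= mem_rcons inE eqxx.
Qed.
End Ideals.

(** * The Koszul complex modulo an ideal *)

Section Koszul.
Variable R : comNzRingType.
Implicit Types (J : set R) (z a : nat -> R).

(** The exterior algebra on e_0, ..., e_(m-1) over R, built as an iterated
    cone: a pair (x, y) of elements of [koszul m'] stands for x + e_m' /\ y.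
    Operations and proofs are then recursions on m, with no signs of
    permutations. *)
Fixpoint koszul (m : nat) : lmodType R :=
  if m is m'.+1 then (koszul m' * koszul m')%type : lmodType R else R^o.
Arguments koszul : simpl never.

Definition kpair m (x y : koszul m) : koszul m.+1 := (x, y).

Lemma koszulSP m (P : koszul m.+1 -> Prop) :
  (forall x y, P (kpair x y)) -> forall c, P c.
Proof. by move=> h [x y]; apply: h. Qed.

(** The Koszul differential with e_i |-> z_i; the sign comes from
    d (e /\ y) = z y - e /\ d y. *)
Fixpoint kdiff z m : koszul m -> koszul m :=
  if m is m'.+1 return koszul m -> koszul m then
    fun c => kpair (kdiff z c.1 + z m' *: c.2) (- kdiff z c.2)
  else fun=> 0.

(** Left exterior multiplication by a_0 e_0 + ... + a_(m-1) e_(m-1). *)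
Fixpoint kwedge a m : koszul m -> koszul m :=
  if m is m'.+1 return koszul m -> koszul m then
    fun c => kpair (kwedge a c.1) (a m' *: c.1 - kwedge a c.2)
  else fun=> 0.

(** Homogeneity of exterior degree q; 0 has every degree. *)
Fixpoint kdeg (q : nat) m : koszul m -> Prop :=
  if m is m'.+1 return koszul m -> Prop then
    fun c => kdeg q c.1 /\ (if q is q'.+1 then kdeg q' c.2 else c.2 = 0)
  else fun c => q = 0%N \/ c = 0.

(** Membership in J K: congruences modulo J express statements on the Koszul
    complex of R/J inside that of R. *)
Fixpoint kin J m : koszul m -> Prop :=
  if m is m'.+1 return koszul m -> Prop then
    fun c => kin J c.1 /\ kin J c.2
  else fun c => J c.
Arguments kdiff : simpl never.
Arguments kwedge : simpl never.
Arguments kdeg : simpl never.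
Arguments kin : simpl never.

Lemma kpairD m (x1 y1 x2 y2 : koszul m) :
  kpair x1 y1 + kpair x2 y2 = kpair (x1 + x2) (y1 + y2).
Proof. by []. Qed.
Lemma kpairN m (x y : koszul m) : - kpair x y = kpair (- x) (- y).
Proof. by []. Qed.
Lemma kpairZ m b (x y : koszul m) : b *: kpair x y = kpair (b *: x) (b *: y).
Proof. by []. Qed.
Lemma kpair0 m : 0 = kpair (0 : koszul m) 0.
Proof. by []. Qed.
Lemma kdiffS z m (x y : koszul m) :
  kdiff z (kpair x y) = kpair (kdiff z x + z m *: y) (- kdiff z y).
Proof. by []. Qed.
Lemma kwedgeS a m (x y : koszul m) :
  kwedge a (kpair x y) = kpair (kwedge a x) (a m *: x - kwedge a y).
Proof. by []. Qed.

Lemma kdiff_linear z m : linear (@kdiff z m).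
Proof.
elim: m => [|m IH] x; first by move=> c e; rewrite /kdiff scaler0 addr0.
elim/koszulSP=> c1 c2; elim/koszulSP=> e1 e2.
rewrite kpairZ kpairD !kdiffS !IH kpairZ kpairD scalerN opprD.
by rewrite !scalerDr !scalerA [z m * x]mulrC addrACA.
Qed.

HB.instance Definition _ z m :=
  GRing.isLinear.Build R (koszul m) (koszul m) _ (@kdiff z m)
    (@kdiff_linear z m).

Lemma kdiffN z m : {morph @kdiff z m : c / - c}.
Proof. exact: linearN. Qed.
Lemma kdiffD z m : {morph @kdiff z m : c e / c + e}.
Proof. exact: linearD. Qed.
Lemma kdiffB z m : {morph @kdiff z m : c e / c - e}.
Proof. exact: linearB. Qed.
Lemma kdiffZ z m x : {morph @kdiff z m : c / x *: c}.
Proof. move=> c; exact: linearZ. Qed.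

(** The terms in z y cancel, which is what the sign in [kdiff] is for. *)
Lemma kdiffK z m (c : koszul m) : kdiff z (kdiff z c) = 0.
Proof.
elim: m c => [|m IH] //; elim/koszulSP=> c1 c2.
rewrite !kdiffS kdiffN kdiffD kdiffZ !IH add0r scalerN subrr !oppr0.
by [].
Qed.

Lemma kwedge_linear a m : linear (@kwedge a m).
Proof.
elim: m => [|m IH] x; first by move=> c e; rewrite /kwedge scaler0 addr0.
elim/koszulSP=> c1 c2; elim/koszulSP=> e1 e2.
rewrite kpairZ kpairD !kwedgeS !IH kpairZ kpairD; congr kpair.
by rewrite opprD scalerBr scalerDr !scalerA [a m * x]mulrC addrACA.
Qed.

HB.instance Definition _ a m :=
  GRing.isLinear.Build R (koszul m) (koszul m) _ (@kwedge a m)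
    (@kwedge_linear a m).

(** Exterior multiplication by sum a_i e_i is a homotopy between 0 and
    multiplication by sum a_i z_i.  Hence the ideal (z) annihilates Koszul
    homology. *)
Lemma kwedge_homotopy z a m (c : koszul m) :
  kdiff z (kwedge a c) + kwedge a (kdiff z c) =
  (\sum_(i < m) a i * z i) *: c.
Proof.
elim: m c => [|m IH]; first by move=> c; rewrite big_ord0 /kdiff scale0r addr0.
elim/koszulSP=> c1 c2; rewrite big_ord_recr /=.
have wD (x y : koszul m) : kwedge a (x + y) = kwedge a x + kwedge a y.
  exact: linearD.
have wZ x (y : koszul m) : kwedge a (x *: y) = x *: kwedge a y.
  exact: linearZ.
have wN (x : koszul m) : kwedge a (- x) = - kwedge a x.
  exact: linearN.
rewrite !(kdiffS,kwedgeS) kpairD kpairZ; congr kpair.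
  rewrite wD wZ addrACA IH scalerBr scalerA.
  by rewrite subrK scalerDl [a m * z m]mulrC.
rewrite wN opprK kdiffB kdiffZ opprB scalerDr scalerA.
have -> : forall X Y W V : koszul m, (X - Y) + ((Y + V) + W) = X + W + V.
  move=> X Y W V.
  by rewrite -[Y + V + W]addrA [LHS]addrA subrK [V + W]addrC addrA.
by rewrite IH -scalerDl.
Qed.

Lemma kinS J m (x y : koszul m) : kin J (kpair x y) <-> kin J x /\ kin J y.
Proof. by []. Qed.

Section Kin.
Variables (J : set R) (JI : is_ideal J).

Lemma kinP m x (c e : koszul m) : kin J c -> kin J e -> kin J (x *: c + e).
Proof.
elim: m c e => [|m IH]; first exact: JI.2.
elim/koszulSP=> c1 c2; elim/koszulSP=> e1 e2 /kinS[? ?] /kinS[? ?].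
by rewrite kpairZ kpairD; apply/kinS; split; apply: IH.
Qed.

Lemma kin0 m : kin J (0 : koszul m).
Proof. by elim: m => [|m IH]; [exact: JI.1 | split]. Qed.

Lemma kinZ m x (c : koszul m) : kin J c -> kin J (x *: c).
Proof. by move=> h; rewrite -[_ *: _]addr0; apply: kinP => //; apply: kin0. Qed.

Lemma kinD m (c e : koszul m) : kin J c -> kin J e -> kin J (c + e).
Proof. by move=> hc; rewrite -[c]scale1r; apply: kinP. Qed.

Lemma kinN m (c : koszul m) : kin J c -> kin J (- c).
Proof. by rewrite -scaleN1r; apply: kinZ. Qed.

Lemma kinB m (c e : koszul m) : kin J c -> kin J e -> kin J (c - e).
Proof. by move=> ? /kinN; apply: kinD. Qed.

Lemma kin_scale m x (c : koszul m) : J x -> kin J (x *: c).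
Proof.
move=> Jx; elim: m c => [|m IH] c.
  by rewrite -[_ *: _]addr0 [x *: c]mulrC; apply: JI.2 => //; apply: JI.1.
by elim/koszulSP: c => c1 c2; rewrite kpairZ; split; apply: IH.
Qed.

Lemma kin_diff z m (c : koszul m) : kin J c -> kin J (kdiff z c).
Proof.
elim: m c => [|m IH]; first by move=> c _; apply: kin0.
elim/koszulSP=> c1 c2 /kinS[h1 h2]; rewrite kdiffS; apply/kinS; split.
  by apply: kinD; [apply: IH | apply: kinZ].
by apply: kinN; apply: IH.
Qed.

Lemma kin_wedge a m (c : koszul m) : kin J c -> kin J (kwedge a c).
Proof.
elim: m c => [|m IH]; first by move=> c _; apply: kin0.
elim/koszulSP=> c1 c2 /kinS[h1 h2]; rewrite kwedgeS; apply/kinS; split.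
  exact: IH.
by apply: kinB; [apply: kinZ | apply: IH].
Qed.
End Kin.

Lemma kdegS q m (x y : koszul m) :
  kdeg q.+1 (kpair x y) <-> kdeg q.+1 x /\ kdeg q y.
Proof. by []. Qed.
Lemma kdegS0 m (x y : koszul m) :
  kdeg 0 (kpair x y) <-> kdeg 0 x /\ y = 0.
Proof. by []. Qed.

Lemma kdeg0 q m : kdeg q (0 : koszul m).
Proof.
elim: m q => [|m IH] q; first by right.
by rewrite kpair0; case: q => [|q]; split=> //; apply: IH.
Qed.

Lemma kdegP q m x (c e : koszul m) :
  kdeg q c -> kdeg q e -> kdeg q (x *: c + e).
Proof.
elim: m q c e => [|m IH] q.
  move=> c e [->|->]; first by left.
  by case=> [->|->]; [left | right; rewrite scaler0 addr0].
elim/koszulSP=> c1 c2; elim/koszulSP=> e1 e2; case: q => [|q].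
  move=> /kdegS0[? ->] /kdegS0[? ->].
  rewrite kpairZ kpairD scaler0 addr0; apply/kdegS0; split=> //; exact: IH.
move=> /kdegS[? ?] /kdegS[? ?].
by rewrite kpairZ kpairD; apply/kdegS; split; apply: IH.
Qed.

Lemma kdegZ q m x (c : koszul m) : kdeg q c -> kdeg q (x *: c).
Proof. by move=> h; rewrite -[_ *: _]addr0; apply: kdegP (kdeg0 _ _). Qed.

Lemma kdegD q m (c e : koszul m) : kdeg q c -> kdeg q e -> kdeg q (c + e).
Proof. by move=> hc; rewrite -[c]scale1r; apply: kdegP. Qed.

Lemma kdegN q m (c : koszul m) : kdeg q c -> kdeg q (- c).
Proof. by rewrite -scaleN1r; apply: kdegZ. Qed.

Lemma kdegB q m (c e : koszul m) : kdeg q c -> kdeg q e -> kdeg q (c - e).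
Proof. by move=> ? /kdegN; apply: kdegD. Qed.

Lemma kdiff_deg0 z m (c : koszul m) : kdeg 0 c -> kdiff z c = 0.
Proof.
elim: m c => [|m IH] //; elim/koszulSP=> c1 c2 /kdegS0[h1 ->].
by rewrite kdiffS scaler0 addr0 linear0 oppr0 IH.
Qed.

Lemma kdeg_diff q z m (c : koszul m) : kdeg q.+1 c -> kdeg q (kdiff z c).
Proof.
elim: m q c => [|m IH] q; first by move=> c _; apply: kdeg0.
elim/koszulSP=> c1 c2 /kdegS[h1 h2]; rewrite kdiffS.
have {}h1 : kdeg q (kdiff z c1 + z m *: c2).
  by apply: kdegD; [apply: IH | apply: kdegZ].
case: q h1 h2 => [|q] h1 h2; last by split=> //; apply: kdegN; apply: IH.
by apply/kdegS0; rewrite (kdiff_deg0 _ h2) oppr0.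
Qed.

Lemma kdeg_wedge q a m (c : koszul m) : kdeg q c -> kdeg q.+1 (kwedge a c).
Proof.
elim: m q c => [|m IH] q; first by move=> c _; apply: kdeg0.
elim/koszulSP=> c1 c2; rewrite kwedgeS; case: q => [|q].
  case/kdegS0=> h1 ->; rewrite linear0 subr0; apply/kdegS; split.
    exact: IH.
  exact: kdegZ.
case/kdegS=> h1 h2; apply/kdegS; split; first exact: IH.
by apply: kdegB; [apply: kdegZ | apply: IH].
Qed.

Lemma kdeg_gt q m (c : koszul m) : (m < q)%N -> kdeg q c -> c = 0.
Proof.
elim: m q c => [|m IH] [|q] //; first by move=> c _ [].
elim/koszulSP=> c1 c2 ltmq /kdegS[h1 h2].
by rewrite (IH _ _ _ h1) ?(IH _ _ _ h2) // ltnW.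
Qed.

(** The coefficient of s can be chosen of the same exterior degree: the
    congruence modulo J + (s) is solved entry by entry, and 0 works at the
    entries where c vanishes for degree reasons. *)
Lemma kin_addp J s q m (c : koszul m) :
  is_ideal J -> kin (ideal_addp J s) c -> kdeg q c ->
  exists y, kdeg q y /\ kin J (c - s *: y).
Proof.
move=> JI; elim: m q c => [|m IH] q.
  move=> c [x hx] [->|->]; first by exists x; split; [left|].
  by exists 0; split; [right | rewrite scaler0 subr0; apply: JI.1].
elim/koszulSP=> c1 c2 /kinS[i1 i2]; case: q => [|q].
  case/kdegS0=> d1 ->; have [y [dy iy]] := IH _ _ i1 d1.
  exists (kpair y 0); split; first by apply/kdegS0.
  rewrite kpairZ kpairN kpairD scaler0 subr0; split=> //; exact: kin0.
case/kdegS=> d1 d2.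
have [y [dy iy]] := IH _ _ i1 d1; have [x [dx ix]] := IH _ _ i2 d2.
by exists (kpair y x); split; [apply/kdegS | rewrite kpairZ kpairN kpairD].
Qed.

(** Vanishing of the q-th Koszul homology H_q(z; R/J). *)
Definition koszul_exact z m J q : Prop :=
  forall c : koszul m, kdeg q c -> kin J (kdiff z c) ->
  exists2 b, kdeg q.+1 b & kin J (c - kdiff z b).

Lemma kin_regular J s m (c : koszul m) :
  (forall f, J (s * f) -> J f) -> kin J (s *: c) -> kin J c.
Proof.
move=> sreg; elim: m c => [|m IH]; first exact: sreg.
by elim/koszulSP=> c1 c2; rewrite kpairZ => /kinS[? ?]; split; apply: IH.
Qed.

(** The descent step.  Since s is regular modulo J, the long exact sequence of
      0 -> R/J -s-> R/J -> R/(J + (s)) -> 0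
    makes multiplication by s injective on H_q(z; R/J) once
    H_(q+1)(z; R/(J + (s))) = 0.  But s^N lies in J + (z), so it acts as 0 by
    [kwedge_homotopy].  An injective nilpotent map lives only on 0. *)
Lemma koszul_exact_regular z m J s q N a :
  is_ideal J -> (forall f, J (s * f) -> J f) ->
  J (s ^+ N - \sum_(i < m) a i * z i) ->
  koszul_exact z m (ideal_addp J s) q.+1 -> koszul_exact z m J q.
Proof.
move=> JI sreg sN ex c dc zc.
(* s^N kills the class of c; the induction on N then removes one s at a time. *)
have: exists2 b, kdeg q.+1 b & kin J (s ^+ N *: c - kdiff z b).
  exists (kwedge a c); first exact: kdeg_wedge.
  have -> : s ^+ N *: c - kdiff z (kwedge a c) =
     (s ^+ N - \sum_(i < m) a i * z i) *: c + kwedge a (kdiff z c).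
    by rewrite scalerBl -(kwedge_homotopy z) opprD addrA subrK.
  by apply: kinD => //; [apply: kin_scale | apply: kin_wedge].
elim: N {sN} => [|N IHN]; first by rewrite expr0 scale1r.
case=> b db zb; apply: IHN.
set c' := s ^+ N *: c in zb *.
have {}zb : kin J (s *: c' - kdiff z b) by rewrite /c' scalerA -exprS.
(* s c' is the boundary of b modulo J, so b is a cycle modulo J + (s). *)
have /ex[//|b' db' zb'] : kin (ideal_addp J s) (kdiff z b).
  have: kin J (kdiff z b - s *: c') by rewrite -opprB; apply: kinN.
  move: (kdiff z b) (c') => u v {c' db b zb ex dc zc c}.
  elim: m u v => [|m IH]; first by move=> u v ?; exists v.
  elim/koszulSP=> u1 u2; elim/koszulSP=> v1 v2.
  by rewrite kpairZ kpairN kpairD => /kinS[/IH ? /IH ?]; split.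
have [y [dy iy]] : exists y, kdeg q.+1 y /\ kin J (b - kdiff z b' - s *: y).
  by apply: kin_addp => //; apply: kdegB => //; apply: kdeg_diff.
exists y => //; apply: (kin_regular sreg).
have -> : s *: (c' - kdiff z y) =
    (s *: c' - kdiff z b) + kdiff z (b - kdiff z b' - s *: y).
  by rewrite !kdiffB kdiffK subr0 kdiffZ addrA subrK scalerBr.
by apply: kinD => //; apply: kin_diff.
Qed.

(** There is nothing in exterior degree beyond the number of variables. *)
Lemma koszul_exact_top z m J q :
  (m < q)%N -> is_ideal J -> koszul_exact z m J q.
Proof.
move=> ltmq JI c /(kdeg_gt ltmq)-> _; exists 0; first exact: kdeg0.
by rewrite linear0 subrr; apply: kin0.
Qed.

(** Depth sensitivity of the Koszul complex: each term of s reduces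
    vanishing in degree q to vanishing in degree q + 1 for a smaller quotient
    ring, and beyond degree m vanishing is free. *)
Lemma koszul_exact_regular_sequence (z : nat -> R) m I (s : seq R) N q :
  is_ideal I -> regular_sequence I s ->
  (forall x, x \in s ->
     exists a : nat -> R, I (x ^+ N - \sum_(i < m) a i * z i)) ->
  (m < q + size s)%N ->
  koszul_exact z m I q.
Proof.
move=> II [sreg _] sN ltm.
pose J i := ideal_add I (ideal_gen [set` take i s]).
have JI i : is_ideal (J i).
  by apply: ideal_add_is_ideal => //; apply: ideal_gen_is_ideal.
have subIJ i : I `<=` J i by apply: ideal_addl; exact: (ideal_gen_is_ideal _).1.
have JS i : (i < size s)%N -> J i.+1 = ideal_addp (J i) s`_i.
  by move=> lti; rewrite /J (take_nth 0) // ideal_add_gen_rcons.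
have -> : I = J 0%N.
  apply/seteqP; split; first exact: subIJ.
  move=> _ [u Iu [v gv <-]]; apply: is_idealD => //.
  by apply: ideal_gen_min gv => //; rewrite take0.
suff H i j : (i + j = size s)%N -> koszul_exact z m (J i) (q + i)%N.
  by rewrite -[q]addn0; apply: (H 0%N (size s)).
elim: j i => [|j IH] i ej.
  by apply: koszul_exact_top => //; rewrite -[i]addn0 ej.
have lti : (i < size s)%N by rewrite -ej addnS ltnS leq_addr.
have [a Ia] := sN _ (mem_nth 0 lti).
apply: (koszul_exact_regular (s := s`_i) (N := N) (a := a)) => //.
- by move=> f; apply: sreg.
- exact: subIJ.
- by rewrite -JS // -addnS; apply: IH; rewrite addSnnS.
Qed.

(** The coefficient of 1, that is, the entry of exterior degree 0. *)
Fixpoint kcst m : koszul m -> R :=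
  if m is m'.+1 return koszul m -> R then fun c => kcst c.1 else id.
Fixpoint kone m : koszul m :=
  if m is m'.+1 return koszul m then kpair (kone m') 0 else 1.

Lemma kcst_linear m x (c e : koszul m) :
  kcst (x *: c + e) = x * kcst c + kcst e.
Proof. by elim: m c e => [|m IH] // [c1 c2] [e1 e2]; apply: IH. Qed.

Lemma kcst_one m x : kcst (x *: kone m) = x.
Proof. by elim: m => [|m IH]; [apply: mulr1 | apply: IH]. Qed.

Lemma kdiff_one z m : kdiff z (kone m) = 0.
Proof.
elim: m => [|m IH] //.
by rewrite [kone _]/(kpair (kone m) 0) kdiffS IH scaler0 addr0 linear0 oppr0.
Qed.

Lemma kdeg_one m : kdeg 0 (kone m).
Proof. by elim: m => [|m IH]; [left | split]. Qed.

Lemma kcst_diff z J m (c : koszul m) : is_ideal J -> kin J c ->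
  exists2 g : nat -> R, forall i, J (g i) &
    kcst (kdiff z c) = \sum_(i < m) g i * z i.
Proof.
move=> JI; have kcstJ k (e : koszul k) : kin J e -> J (kcst e).
  by elim: k e => [|k IH] // [e1 e2] [h _]; apply: IH.
elim: m c => [|m IH] c.
  by exists (fun=> 0) => [i|]; [exact: JI.1 | rewrite big_ord0].
elim/koszulSP: c => c1 c2 /kinS[/IH[g Jg eg] h2].
exists (fun i => if i == m then kcst c2 else g i).
  by move=> i; case: ifP => // _; apply: kcstJ.
rewrite kdiffS big_ord_recr /= eqxx.
transitivity (kcst (z m *: c2 + kdiff z c1)); first by rewrite addrC.
rewrite kcst_linear eg addrC mulrC; congr (_ + _).
by apply: eq_bigr => i _; rewrite ltn_eqF.
Qed.

(** If H_1(z; R/J) = 0 then the intersection of J with (z) is (z) J.  A relation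
    sum h_i z_i in J is a cycle modulo J of exterior degree 1; being a boundary
    up to an element u of J K, it has the same differential as u, whose entries
    are in J. *)
Lemma koszul_exact1 z m J (h : nat -> R) : is_ideal J -> koszul_exact z m J 1 ->
  J (\sum_(i < m) h i * z i) ->
  exists2 g : nat -> R, forall i, J (g i) &
    \sum_(i < m) h i * z i = \sum_(i < m) g i * z i.
Proof.
move=> JI ex Jh.
have wE : kdiff z (kwedge h (kone m)) = (\sum_(i < m) h i * z i) *: kone m.
  by rewrite -kwedge_homotopy kdiff_one linear0 addr0.
have [||b _ zb] := ex (kwedge h (kone m)).
- exact/kdeg_wedge/kdeg_one.
- by rewrite wE; apply: kin_scale.
have [g Jg eg] := kcst_diff z JI zb; exists g => //.
by rewrite -eg kdiffB kdiffK subr0 wE kcst_one.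
Qed.

End Koszul.

(** * Macaulay duality *)

Section Separation.
Variables (k : fieldType) (N : nat) (W : set 'rV[k]_N).
Hypothesis W0 : W 0.
Hypothesis WP : forall a u v, W u -> W v -> W (a *: u + v).

(** A subspace known only as a predicate has a matrix of generators: take one of
    largest rank among those whose rows lie in W. *)
Lemma subspace_row_space :
  exists A : 'M[k]_N, forall w : 'rV_N, W w <-> (w <= A)%MS.
Proof.
pose P r := `[< exists2 A : 'M[k]_N,
  forall w : 'rV_N, (w <= A)%MS -> W w & \rank A = r >].
have exP : exists r, P r.
  exists 0%N; apply/asboolP; exists 0; last exact: mxrank0.
  by move=> w /submx0null->.
have leP r : P r -> (r <= N)%N.
  by move=> /asboolP[A _ <-]; apply: rank_leq_row.
case: (ex_maxnP exP leP) => r /asboolP[A AW rA] rmax.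
exists A => w; split; last exact: AW.
move=> Ww; have : P (\rank (A + w)%MS).
  apply/asboolP; exists (A + w)%MS => // u /sub_addsmxP[[x y] /= ->].
  have [b ->] : exists b : k, y *m w = b *: w.
    by exists (y 0 0); rewrite -mul_scalar_mx [y in LHS]mx11_scalar.
  by rewrite addrC; apply: WP => //; apply: AW; apply: submxMl.
move=> /rmax; rewrite -rA => le.
apply: submx_trans (addsmxSr A w) _.
by rewrite -(geq_leqif (mxrank_leqif_sup (addsmxSl A w))).
Qed.

(** A row vector lies in the row space of A exactly when the cokernel of A kills
    it, so some column of the cokernel detects v. *)
Lemma separating_functional (v : 'rV[k]_N) : ~ W v ->
  exists2 phi : 'cV[k]_N, v *m phi <> 0 & forall w, W w -> w *m phi = 0.
Proof.
have [A AW] := subspace_row_space => Wv.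
have /matrix0Pn[i [j nz]] : v *m cokermx A != 0.
  by rewrite -submxE; apply/negP => /AW.
exists (col j (cokermx A)).
  rewrite colE mulmxA -colE => /matrixP/(_ i 0).
  by rewrite mxE [RHS]mxE => e; rewrite e eqxx in nz.
by move=> w /AW; rewrite submxE colE mulmxA => /eqP->; rewrite mul0mx.
Qed.
End Separation.

Section Duality.
Variables (k : fieldType) (n : nat).
Local Notation R := {mpoly k[n]}.
Implicit Types (I J : set R) (f h : R) (F : dpring k n).

Lemma contractE h F L :
  (contract h F)@_L = \sum_(M <- msupp h) h@_M * (F@_(L + M)).
Proof.
rewrite /contract raddf_sum /=; apply: eq_bigr => M _.
rewrite raddf_sum /= big_mkcond /=.
transitivity (\sum_(K <- msupp F) if K == (L + M)%MM then h@_M * F@_K else 0).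
  apply: eq_bigr => K _; rewrite mcoeffZ mcoeffX.
  have [->|ne] := eqVneq K (L + M)%MM.
    by rewrite lem_addl addmK eqxx mulr1.
  case: ifP => // le; case: eqP; rewrite ?mulr0 // => e.
  by rewrite -e submK ?eqxx in ne.
have [LMF|LMF] := boolP ((L + M)%MM \in msupp F).
  rewrite (bigD1_seq (L + M)%MM) ?msupp_uniq //= eqxx big1 ?addr0 // => K.
  by move=> /negPf->.
rewrite (memN_msupp_eq0 LMF) mulr0 big_seq big1 // => K KF.
by case: eqP => // e; rewrite -e KF in LMF.
Qed.

(** Since R is commutative, f kills all of <F> as soon as it kills F. *)
Lemma contractC f h F : contract f (contract h F) = contract h (contract f F).
Proof.
apply/mpolyP => L; rewrite !contractE.
under eq_bigr => M _ do rewrite contractE mulr_sumr.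
rewrite exchange_big /=; apply: eq_bigr => M _.
rewrite contractE mulr_sumr; apply: eq_bigr => K _.
by rewrite mulrCA -!addmA [(M + K)%MM]addmC.
Qed.

Lemma contract0 h : contract h 0 = 0 :> dpring k n.
Proof.
apply/mpolyP => L; rewrite contractE mcoeff0 big1 // => M _.
by rewrite mcoeff0 mulr0.
Qed.

Lemma contract1 F : contract 1 F = F.
Proof.
apply/mpolyP => L.
by rewrite contractE msupp1 big_seq1 mcoeff1 eqxx mul1r addm0.
Qed.

(** Multiplying by a form of degree t shifts homogeneous components by t. *)
Lemma pihomogM_dhomog e t f h : h \is t.-homog ->
  pihomog mdeg e (f * h) =
  if (t <= e)%N then pihomog mdeg (e - t) f * h else 0.
Proof.
move=> ht.
(* Only the component of f of degree e - t contributes. *)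
have -> : f * h = \sum_(i < msize f) pihomog mdeg i f * h.
  by rewrite -mulr_suml -pihomog_partitionE.
have hM i : pihomog mdeg i f * h \is (i + t).-homog.
  by apply: dhomogM => //; apply: pihomogP.
rewrite raddf_sum /=; case: ifP => let_e; last first.
  rewrite big1 // => i _; apply: (pihomog_ne0 _ (hM i)).
  by apply: contraFneq let_e => <-; apply: leq_addl.
have [lt|ge] := ltnP (e - t) (msize f).
  rewrite (bigD1 (Ordinal lt)) //= big1 ?addr0.
    by rewrite pihomog_dE // -{2}(subnK let_e).
  move=> i ne; apply: (pihomog_ne0 _ (hM i)).
  by apply: contraNneq ne => e'; apply/eqP/val_inj; rewrite /= -e' addnK.
rewrite big1 => [|i _].
  rewrite pihomogE big_seq_cond big1 ?mul0r // => m /andP[mf /eqP me].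
  by have := msize_mdeg_lt mf; rewrite me ltnNge ge.
apply: (pihomog_ne0 _ (hM i)); apply/eqP => e'.
by have := ltn_ord i; rewrite ltnNge (leq_trans ge) // -e' addnK.
Qed.

Definition graded J := forall f e, J f -> J (pihomog mdeg e f).

Lemma graded_gen (S : set R) : (forall h, S h -> exists t, h \is t.-homog) ->
  graded (ideal_gen S).
Proof.
move=> Sh f e [s [sS ->]]; rewrite raddf_sum /=.
rewrite big_seq_cond; apply: is_ideal_sum; first exact: ideal_gen_is_ideal.
move=> p /andP[/sS Sp _]; have [t tp] := Sh _ Sp.
rewrite (pihomogM_dhomog _ _ tp); case: ifP => _.
  by apply: is_idealM; [exact: ideal_gen_is_ideal | exact: ideal_gen_sub].
exact: (ideal_gen_is_ideal _).1.
Qed.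

Lemma graded_add I J : graded I -> graded J -> graded (ideal_add I J).
Proof.
move=> gI gJ _ e [u Iu [v Jv <-]]; rewrite pihomogD.
exists (pihomog mdeg e u); first exact: gI.
by exists (pihomog mdeg e v); first exact: gJ.
Qed.

Lemma msize_pihomog e f : (msize (pihomog mdeg e f) <= e.+1)%N.
Proof.
rewrite msizeE; apply/bigmax_leqP_seq => m mf _; rewrite ltnS.
by rewrite (dhomog_mf (pihomogP mdeg e f) mf).
Qed.

(** Macaulay duality: J^perp detects membership in J.  A linear form lam on the
    polynomials of degree e that kills the degree e part of J but not that of f
    is the element g with coefficients lam X^K, and the coefficient of X^[L] in
    h o g is lam (x^L h).  This vanishes for h in J, as J is an ideal. *)
Lemma graded_dual J e f : is_ideal J -> graded J ->
  ~ J (pihomog mdeg e f) ->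
  exists g : dpring k n, [/\ perp J g, dphomog e g & contract f g <> 0].
Proof.
move=> JI gJ nJf; pose T : finType := 'X_{1..n < e.+1}; pose N := #|{: T}|.
pose mon (i : 'I_N) : 'X_{1..n < e.+1} := (enum_val i : T).
pose row_of (p : R) : 'rV[k]_N := \row_i (pihomog mdeg e p)@_(mon i).
pose poly_of (w : 'rV[k]_N) : R := \sum_i w 0 i *: 'X_[mon i].
have row_ofK p : poly_of (row_of p) = pihomog mdeg e p.
  rewrite [RHS](mpolywE (msize_pihomog e p)).
  rewrite (reindex_onto mon (@enum_rank T)) /=.
    under [RHS]eq_bigl => i do rewrite /mon enum_valK eqxx.
    by apply: eq_bigr => i _; rewrite mxE.
  by move=> i _; rewrite /mon enum_rankK.
pose W : set 'rV[k]_N := [set w | J (poly_of w)].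
have W0 : W 0.
  have -> : W 0 = J 0.
    by rewrite /W /= /poly_of big1 // => i _; rewrite mxE scale0r.
  exact: JI.1.
have WP a u v : W u -> W v -> W (a *: u + v).
  rewrite /W /= => Wu Wv.
  have -> : poly_of (a *: u + v) = a%:MP * poly_of u + poly_of v.
    rewrite /poly_of mulr_sumr -big_split; apply: eq_bigr => i _ /=.
    by rewrite !mxE scalerDl mul_mpolyC scalerA.
  exact: JI.2.
have [|phi nz phiW] := separating_functional W0 WP (v := row_of f).
  by rewrite /W /= row_ofK.
pose lam (p : R) : k := (row_of p *m phi) 0 0.
have lamP a p q : lam (a *: p + q) = a * lam p + lam q.
  rewrite /lam; have -> : row_of (a *: p + q) = a *: row_of p + row_of q.
    by apply/rowP => i; rewrite !mxE linearP mcoeffD mcoeffZ.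
  by rewrite mulmxDl -scalemxAl !mxE.
have lam0 p : pihomog mdeg e p = 0 -> lam p = 0.
  move=> p0; rewrite /lam; have -> : row_of p = 0.
    by apply/rowP => i; rewrite !mxE p0 mcoeff0.
  by rewrite mul0mx mxE.
have lamE L (h : R) :
    lam (h * 'X_[L]) = \sum_(M <- msupp h) h@_M * lam 'X_[L + M].
  have lam00 : lam 0 = 0 by apply: lam0; rewrite pihomog0.
  rewrite {1}[h]mpolyE mulr_suml.
  elim: (msupp h) => [|M s IH]; first by rewrite !big_nil.
  by rewrite !big_cons -scalerAl lamP IH -mpolyXD addmC.
(* lam vanishes on monomials of degree above e, so g has all the coefficients
   lam X^K. *)
pose g : dpring k n := \sum_(m : 'X_{1..n < e.+1}) lam 'X_[m] *: 'X_[m].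
have lamX K : mdeg K != e -> lam 'X_[K] = 0.
  by move=> ne; apply: lam0; rewrite pihomogX (negPf ne).
have gE K : g@_K = lam 'X_[K].
  rewrite /g raddf_sum /=.
  under eq_bigr => m _ do rewrite mcoeffZ mcoeffX.
  have [lt|ge] := ltnP (mdeg K) e.+1.
    rewrite (bigD1 (BMultinom lt)) //= eqxx mulr1 big1 ?addr0 // => m ne.
    by case: eqP => [eK|_]; [case/eqP: ne; apply: val_inj | rewrite mulr0].
  rewrite lamX ?gtn_eqF // big1 // => m _.
  case: eqP => [eK|_]; last by rewrite mulr0.
  by have := bmdeg m; rewrite eK ltnNge ge.
have gc h L : (contract h g)@_L = lam (h * 'X_[L]).
  by rewrite contractE lamE; apply: eq_bigr => M _; rewrite gE.
exists g; split.
- move=> h Jh; apply/mpolyP => L; rewrite gc mcoeff0 /lam phiW ?mxE //.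
  rewrite /W /= row_ofK; apply: gJ; rewrite mulrC; exact: is_idealM.
- move=> K; rewrite mcoeff_msupp gE => nzK; apply/eqP.
  by apply: contraNT nzK => /lamX->.
- move=> /mpolyP/(_ 0%MM); rewrite gc mcoeff0 mpolyX0 mulr1 => l0.
  by apply: nz; apply/matrixP => i j; rewrite !ord1 [RHS]mxE; exact: l0.
Qed.
End Duality.

(** * The regularity bound *)

Section GradedIdeals.
Variables (k : fieldType) (n : nat).
Local Notation R := {mpoly k[n]}.
Implicit Types (I J : set R) (f h : R) (F : dpring k n).

Lemma linear_sequence_homog d (z : 'I_d -> R) : linear_sequence z ->
  forall i, z i \is 1.-homog.
Proof. by case=> m [b [j [_ _ zE]]] i; rewrite zE; apply: dhomog_is_dhomog. Qed.

Lemma zpow_ideal_graded d (z : 'I_d -> R) L : (forall i, z i \is 1.-homog) ->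
  graded (zpow_ideal z L).
Proof.
move=> zh; apply: graded_gen => _ [i _ <-]; exists (1 * L i)%N.
exact: dhomogMn.
Qed.

Lemma zpow_idealP d (z : 'I_d -> R) L f :
  zpow_ideal z L f <-> exists a : 'I_d -> R, f = \sum_i a i * z i ^+ L i.
Proof.
split=> [|[a ->]]; last first.
  apply: is_ideal_sum; first exact: ideal_gen_is_ideal.
  move=> i _; apply: is_idealM; first exact: ideal_gen_is_ideal.
  by apply: ideal_gen_sub; exists i.
move: f; apply: ideal_gen_min => [|_ [i _ <-]].
  split; first by exists (fun=> 0); rewrite big1 // => i _; rewrite mul0r.
  move=> x _ _ [a ->] [b ->]; exists (fun i => x * a i + b i).
  rewrite mulr_sumr -big_split; apply: eq_bigr => i _ /=.
  by rewrite mulrDl mulrA.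
exists (fun j => (j == i)%:R); rewrite (bigD1 i) //= eqxx mul1r big1 ?addr0 //.
by move=> j /negPf->; rewrite mul0r.
Qed.

(** Contraction does not raise degrees. *)
Lemma contract_degree r h F e :
  dphomog r F -> dphomog e (contract h F) -> (r < e)%N -> contract h F = 0.
Proof.
move=> Fr he lt; apply/mpolyP => L; rewrite mcoeff0.
have [LhF|/memN_msupp_eq0//] := boolP (L \in msupp (contract h F)).
rewrite contractE big1 // => M _.
have [|/memN_msupp_eq0->] := boolP ((L + M)%MM \in msupp F); last exact: mulr0.
move=> /Fr; rewrite mdegD (he _ LhF) => er.
by move: lt; rewrite -er ltnNge leq_addr.
Qed.

(** The inclusion of Ann(F) in J when J^perp = <F>: if f kills F then it kills
    all of J^perp, so by duality no component of f is outside J. *)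
Lemma annihilator_sub J F f e : is_ideal J -> graded J ->
  perp J = cyclic F -> contract f F = 0 -> J (pihomog mdeg e f).
Proof.
move=> JI gJ pJ fF; apply: contrapT => nJ.
have [g [gperp _]] := graded_dual JI gJ nJ; apply.
by move: gperp; rewrite pJ => -[h _ <-]; rewrite contractC fF contract0.
Qed.

(** If J^perp is generated in degree r, it has nothing in degrees above r, so J
    contains every form of such a degree. *)
Lemma inverse_system_cofinite J F r f e : is_ideal J -> graded J ->
  perp J = cyclic F -> dphomog r F -> (r < e)%N -> J (pihomog mdeg e f).
Proof.
move=> JI gJ pJ Fr lt; apply: contrapT => nJ.
have [g [gperp ge]] := graded_dual JI gJ nJ; apply.
move: gperp ge; rewrite pJ => -[h _ <-] he.
by rewrite (contract_degree Fr he lt) contract0.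
Qed.

Lemma pihomogM_linear e f h : h \is 1.-homog ->
  pihomog mdeg e.+1 (f * h) = h * pihomog mdeg e f.
Proof. by move=> h1; rewrite (pihomogM_dhomog _ _ h1) subn1 /= mulrC. Qed.

(** Forms of positive degree lie in the ideal of the variables, with forms of
    one degree less as coefficients. *)
Lemma homog_as_combination e f : f \is e.+1.-homog ->
  exists p : 'I_n -> R, (forall i, p i \is e.-homog) /\ f = \sum_i 'X_i * p i.
Proof.
move=> fh; rewrite [f]mpolyE.
have : forall m, m \in msupp f -> mdeg m = e.+1 by apply: dhomog_mf.
elim: (msupp f) => [|m s IH] sh.
  exists (fun=> 0); split; first by move=> i; apply: dhomog0.
  by rewrite big_nil big1 // => i _; rewrite mulr0.
have [|p [ph e1]] := IH; first by move=> K Ks; apply: sh; rewrite inE Ks orbT.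
have me : mdeg m = e.+1 by apply: sh; rewrite inE eqxx.
have [j mj] : exists j, (0 < m j)%N.
  apply/existsP; move: me; rewrite mdegE; apply: contra_eqT => /existsPn m0.
  by rewrite big1 // => i _; apply/eqP; rewrite -leqn0 leqNgt.
have mE : m = (U_(j) + (m - U_(j)))%MM.
  rewrite addmC submK //; apply/mnm_lepP => i; rewrite mnm1E.
  by case: eqP => // <-.
exists (fun i => p i + (if i == j then f@_m *: 'X_[m - U_(j)] else 0)); split.
  move=> i; apply: dhomogD => //; case: ifP => _; last exact: dhomog0.
  apply: dhomogZ; rewrite dhomogX; apply/eqP/succn_inj; rewrite -me [in RHS]mE.
  by rewrite mdegD mdeg1 add1n.
rewrite big_cons e1; under [RHS]eq_bigr => i _ do rewrite mulrDr.
rewrite big_split addrC /=; congr (_ + _).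
rewrite (bigD1 j) //= eqxx big1 ?addr0; last first.
  by move=> i /negPf->; rewrite mulr0.
by rewrite [in 'X_[m]]mE mpolyXD scalerAr.
Qed.

Section Regularity.
Variables (d r : nat) (z : 'I_d -> R) (I : set R).
Hypothesis z_lin : forall i, z i \is 1.-homog.
Hypotheses (I_ideal : is_ideal I) (I_graded : graded I).

(** The regularity bound.  Let f in I be a form of degree e + 1 > r + 1 and write
    f = sum x_i p_i.  Each p_i has degree e > r, hence is congruent to some q_i
    in I modulo (z).  Then f - sum x_i q_i lies both in I and in (z), hence in
    (z) I.  So f is a combination, with linear coefficients, of elements of I,
    and taking components these may be taken of degree e. *)
Lemma generated_in_low_degree :
  (forall h : 'I_d -> R, I (\sum_i h i * z i) ->
     exists2 g : 'I_d -> R, forall i, I (g i) &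
       \sum_i h i * z i = \sum_i g i * z i) ->
  (forall e f, (r < e)%N -> f \is e.-homog ->
     exists a : 'I_d -> R, I (f - \sum_i a i * z i)) ->
  I `<=` ideal_gen [set f | I f /\ (msize f <= r.+2)%N].
Proof.
move=> acyc fin f If.
set I' := ideal_gen _; have I'I : is_ideal I' by apply: ideal_gen_is_ideal.
suff H e (g : R) : g \is e.-homog -> I g -> I' g.
  rewrite (pihomog_partitionE (leqnn (msize f))); apply: is_ideal_sum => // i _.
  by apply: (H i); [apply: pihomogP | apply: I_graded].
elim: e g {f If} => [|e IH] f fe If.
  apply: ideal_gen_sub; split=> //.
  by rewrite -(pihomog_dE fe) (leq_trans (msize_pihomog _ _)).
have [le|lt] := leqP e.+1 r.+1.
  apply: ideal_gen_sub; split=> //.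
  by rewrite -(pihomog_dE fe) (leq_trans (msize_pihomog _ _)).
have [p [ph fE]] := homog_as_combination fe.
have /choice[a pa] i : exists a : 'I_d -> R, I (p i - \sum_j a j * z j).
  exact: fin (ph i).
pose q i := p i - \sum_j a i j * z j.
pose h j := \sum_i 'X_i * a i j.
have fqh : f = \sum_i q i * 'X_i + \sum_j h j * z j.
  have -> : \sum_j h j * z j = \sum_i 'X_i * \sum_j a i j * z j.
    under eq_bigr => j _ do rewrite mulr_suml.
    rewrite exchange_big; apply: eq_bigr => i _ /=.
    by rewrite mulr_sumr; apply: eq_bigr => j _; rewrite mulrA.
  rewrite fE -big_split; apply: eq_bigr => i _ /=.
  by rewrite [q i * _]mulrC -mulrDr subrK.
have [|g Ig hg] := acyc h.
  have -> : \sum_j h j * z j = f - \sum_i q i * 'X_i.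
    by rewrite fqh addrAC subrr add0r.
  apply: is_idealB => //; apply: is_ideal_sum => // i _.
  rewrite mulrC; exact: is_idealM I_ideal (pa i).
rewrite -(pihomog_dE fe) fqh hg pihomogD !raddf_sum /=.
apply: is_idealD => //; apply: is_ideal_sum => // i _.
  have X1 : ('X_i : R) \is 1.-homog by rewrite dhomogX; apply/eqP; exact: mdeg1.
  rewrite (pihomogM_linear _ _ X1).
  apply: is_idealM => //; apply: IH; first exact: pihomogP.
  exact: I_graded (pa i).
rewrite pihomogM_linear //.
by apply: is_idealM => //; apply: IH; [apply: pihomogP | apply: I_graded].
Qed.

(** A form of positive degree has its N-th power in degree at least N > r. *)
Lemma homog_power_in_add_gen N e s : (0 < e)%N -> s \is e.-homog -> (r < N)%N ->
  (forall e f, (r < e)%N -> f \is e.-homog ->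
     exists a : 'I_d -> R, I (f - \sum_i a i * z i)) ->
  exists a : 'I_d -> R, I (s ^+ N - \sum_i a i * z i).
Proof.
move=> e0 se rN; apply; last exact: dhomogMn se.
by apply: leq_trans rN _; rewrite leq_pmull.
Qed.
End Regularity.
End GradedIdeals.

Theorem proposition4p2 (k : fieldType) (n d : nat) (hd : (1 <= d <= n)%N)
  (z : 'I_d -> {mpoly k[n]}) (hz : linear_sequence z)
  (t0 r : nat) (H : 'X_{1..d} -> dpring k n)
  (Hhom : forall L, mpos L -> (mdeg L <= t0)%N -> exists e, dphomog e (H L))
  (Hadm : admissible t0 z H)
  (H1_neq0 : H (mconst d 1) != 0) (H1_deg : dphomog r (H (mconst d 1)))
  (ht0 : ((r + 2) * d <= t0)%N)
  (I : set {mpoly k[n]}) (HI : gorenstein_quot I d)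
  (Hperp : forall L, mpos L -> (mdeg L <= t0)%N ->
     perp (ideal_add I (zpow_ideal z L)) = cyclic (H L)) :
  I = ideal_gen [set f | Ann (H (mconst d (r + 2))) f /\ (msize f <= r + 2)%N].
Proof.
have zlin := linear_sequence_homog hz.
case: HI => -[/idealr_closed_is_ideal II gI] _ [s [s_hom s_reg _]].
have zI L : is_ideal (zpow_ideal z L) by apply: ideal_gen_is_ideal.
have JI L : is_ideal (ideal_add I (zpow_ideal z L)).
  by apply: ideal_add_is_ideal.
have gJ L : graded (ideal_add I (zpow_ideal z L)).
  by apply: graded_add => //; apply: zpow_ideal_graded.
have Hperp_const t : (0 < t <= r + 2)%N ->
    perp (ideal_add I (zpow_ideal z (mconst d t))) = cyclic (H (mconst d t)).
  case/andP=> t0_gt t_le; apply: Hperp => [i|]; first by rewrite mnmE.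
  apply: leq_trans ht0; rewrite mdegE.
  under eq_bigr => i _ do rewrite mnmE.
  by rewrite sum_nat_const card_ord mulnC leq_mul2r t_le orbT.
(* H_(1, ..., 1) has degree r, so A/(z) vanishes in degrees above r. *)
have fin e f : (r < e)%N -> f \is e.-homog ->
    exists a : 'I_d -> {mpoly k[n]}, I (f - \sum_i a i * z i).
  move=> lt fe; have : ideal_add I (zpow_ideal z (mconst d 1)) f.
    rewrite -(pihomog_dE fe).
    apply: (inverse_system_cofinite _ _ _ _ H1_deg) => //.
    by rewrite Hperp_const // addn2.
  case=> u Iu [v /zpow_idealP[a vE] <-]; exists a.
  rewrite vE; under eq_bigr => i _ do rewrite mnmE expr1.
  by rewrite addrK.
have IAnn t : (0 < t <= r + 2)%N -> I `<=` Ann (H (mconst d t)).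
  move=> ht f If.
  have : perp (ideal_add I (zpow_ideal z (mconst d t))) (H (mconst d t)).
    by rewrite Hperp_const //; exists 1 => //; apply: contract1.
  by apply; apply: ideal_addl => //; exact: (zI _).1.
(* A regular sequence of length d forces H_1(z; A) = 0, as z has d terms. *)
have acyc (h : 'I_d -> {mpoly k[n]}) : I (\sum_i h i * z i) ->
    exists2 g : 'I_d -> {mpoly k[n]}, forall i, I (g i) &
      \sum_i h i * z i = \sum_i g i * z i.
  (* The Koszul complex takes families indexed by nat; extend by 0. *)
  pose ext (u : 'I_d -> {mpoly k[n]}) (i : nat) := oapp u 0 (insub i).
  have extE u (i : 'I_d) : ext u i = u i by rewrite /ext valK.
  have sumE (u v : 'I_d -> {mpoly k[n]}) :
      \sum_i u i * v i = \sum_(i < d) ext u i * ext v i.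
    by apply: eq_bigr => i _; rewrite !extE.
  rewrite sumE => /(koszul_exact1 II)[|g Ig ->]; last first.
    by exists (fun i => g i) => //; apply: eq_bigr => i _; rewrite extE.
  apply: (koszul_exact_regular_sequence (N := r.+1) II s_reg); last first.
    by rewrite size_tuple.
  move=> x /s_hom[e e0 xe].
  have [a Ia] := homog_power_in_add_gen e0 xe (ltnSn r) fin.
  by exists (ext a); rewrite -sumE.
apply/seteqP; split.
  apply: subset_trans (generated_in_low_degree zlin II gI acyc fin) _.
  apply: ideal_gen_min; first exact: ideal_gen_is_ideal.
  move=> f [If fr]; apply: ideal_gen_sub; split; last by rewrite addn2.
  by apply: IAnn => //; rewrite addn2 /=.
apply: ideal_gen_min => // f [fAnn fr].
rewrite (pihomog_partitionE fr); apply: is_ideal_sum => // i _.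
(* Below degree r + 2 the ideals I and I + (z^(r+2)) agree. *)
have J_fi : ideal_add I (zpow_ideal z (mconst d (r + 2))) (pihomog mdeg i f).
  by apply: annihilator_sub fAnn => //; apply: Hperp_const; rewrite addn2 /=.
case: J_fi => u Iu [v /zpow_idealP[a vE] fE].
rewrite -(pihomog_id mdeg i f) -fE pihomogD vE raddf_sum big1 ?addr0 /=.
  exact: gI.
move=> j _; rewrite (@pihomogM_dhomog _ _ _ (1 * (r + 2))).
  by rewrite mul1n leqNgt ltn_ord.
by rewrite mnmE; apply: dhomogMn.
Qed.
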